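(* Let $k \geq 1$ and $m \geq 1$ be integers, and let $(f^{(k)}_n)_{n\in\mathbb{Z}}$ be the $k$-generalized Fibonacci sequence defined by $f^{(k)}_n = 0$ for $n<0$, $f^{(k)}_0 = 1$, and $f^{(k)}_n = \sum_{i=1}^{k} f^{(k)}_{n-i}$ for $n \geq 1$. Then the sum of the first $mk$ nonzero terms of this sequence satisfies $$\sum_{n=0}^{mk-1} f^{(k)}_n \;=\; \sum_{i=1}^{m}\sum_{j=1}^{i}\frac{2^{(m-i+1)k}\,(-1)^{j-1}\, k^{j-1}\, S(i,j)\,(m-i+1)^{j-1}}{(i-1)!\cdot 2^{i}},$$ where $S(a,b)$ denotes the unsigned Stirling number of the first kind.
   Context: The unsigned Stirling numbers of the first kind $S(n,k)$ are defined by $S(0,0)=1$, $S(n,0)=S(0,k)=0$ for $n,k>0$, and $S(n,k) = (n-1)S(n-1,k) + S(n-1,k-1)$ for $n,k>0$; equivalently $x(x+1)\cdots(x+n-1) = \sum_{k} S(n,k)x^k$. The nonzero terms of the $k$-generalized Fibonacci sequence are $f^{(k)}_0, f^{(k)}_1, f^{(k)}_2,\dots$, so ''the first $mk$ nonzero terms'' are $f^{(k)}_0,\dots,f^{(k)}_{mk-1}$. *)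

(* Defs.v *)
From mathcomp Require Import all_boot all_order all_algebra.

Set Implicit Arguments.
Unset Strict Implicit.
Unset Printing Implicit Defensive.

Import Order.TTheory GRing.Theory Num.Theory.

Local Open Scope ring_scope.

Fixpoint stirling1 (n k : nat) : nat :=
  match n, k with
  | 0, 0 => 1
  | 0, _.+1 => 0
  | _.+1, 0 => 0
  | n'.+1, k'.+1 => n' * stirling1 n' k'.+1 + stirling1 n' k'
  end%N.

(* The list [:: f_n; f_(n-1); ...; f_0] for the parameter k.  Terms of negative
   index vanish, so summing the (at most) k most recent entries gives the full
   k-term recurrence; see kfib_neg, kfib0 and kfibE. *)
Fixpoint kfib_rev (k n : nat) : seq nat :=
  if n is n'.+1 then
    let s := kfib_rev k n' in sumn (take k s) :: s
  else [:: 1%N].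

Definition kfib (k : nat) (z : int) : nat :=
  match z with
  | Posz n => head 0%N (kfib_rev k n)
  | Negz _ => 0%N
  end.

Lemma kfib_neg (k : nat) (z : int) : z < 0 -> kfib k z = 0%N.
Proof. by case: z. Qed.

Lemma kfib0 (k : nat) : kfib k 0 = 1%N.
Proof. by []. Qed.

Lemma nth_kfib_rev (k n i : nat) :
  nth 0%N (kfib_rev k n) i = kfib k (n%:Z - i%:Z).
Proof.
elim: n i => [|n IHn] [|i]; first by [].
- by rewrite [LHS]/= nth_nil kfib_neg // sub0r oppr_lt0.
- by rewrite subr0.
- by rewrite /= IHn -[n.+1]addn1 -[i.+1]addn1 !PoszD opprD addrACA subrr addr0.
Qed.

Lemma kfibE (k : nat) (z : int) :
  0 < z -> kfib k z = (\sum_(1 <= i < k.+1) kfib k (z - i%:Z))%N.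
Proof.
case: z => [[|n]|] // _.
rewrite big_add1 /=; under eq_bigr => i _.
  rewrite -[n.+1]addn1 -[i.+1]addn1 !PoszD opprD addrACA subrr addr0.
  rewrite -nth_kfib_rev; over.
elim: k (kfib_rev k n) => [|k IHk] [|x s] //=.
- by rewrite big_nil.
- by rewrite big_nil.
- by rewrite big1 // => i _; rewrite nth_nil.
- by rewrite IHk big_nat_recl.
Qed.

(* Main.v *)
Require Import Defs.
From mathcomp Require Import all_boot all_order all_algebra.
From mathcomp Require Import ring zify.

Import Order.TTheory GRing.Theory Num.Theory.

Local Open Scope ring_scope.

(** The partial sums of the k-generalized Fibonacci sequence have generating
    function 1 / (1 - 2x + x^(k+1)), whose N-th coefficient is
    \sum_a (-1)^a 'C(N - ak, a) 2^(N - a(k+1)). For N = mk - 1 and t = (m - a)k,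
    the signed binomial (-1)^a 'C(t - 1, a) is (1 - t)(2 - t)...(a - t) / a!, and
    expanding this rising factorial in powers of t produces the Stirling
    numbers. *)

Lemma stirling1_small (n k : nat) : (n < k)%N -> stirling1 n k = 0%N.
Proof.
elim: n k => [|n IHn] [|k] //; rewrite ltnS => ltnk.
by rewrite /= !IHn ?muln0 // ltnW.
Qed.

Local Arguments stirling1 : simpl never.

(** Rising factorial expansion with one factor [x] cancelled; multiplying by [x + n.+1%:R]
    reproduces the Stirling recurrence. *)
Lemma sum_stirling1 (R : comPzRingType) (x : R) (n : nat) :
  \sum_(j < n.+1) (stirling1 n.+1 j.+1)%:R * x ^+ j = \prod_(b < n) (x + b.+1%:R).
Proof.
elim: n => [|n IHn]; first by rewrite big_ord1 big_ord0; exact: mul1r.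
rewrite [RHS]big_ord_recr /= -IHn mulrDr.
have stirling1SS j :
  stirling1 n.+2 j.+1 = (n.+1 * stirling1 n.+1 j.+1 + stirling1 n.+1 j)%N by [].
under eq_bigr => j _ do rewrite stirling1SS natrD natrM mulrDl -mulrA.
rewrite big_split /= -mulr_sumr big_ord_recr /= (stirling1_small n.+1 n.+2) //.
rewrite mul0r addr0 [X in _ + X = _]big_ord_recl.
rewrite (_ : stirling1 n.+1 ord0 = 0)%N // mul0r add0r addrC.
rewrite [X in _ = _ + X]mulrC; congr (_ + _); rewrite mulr_suml.
by apply: eq_bigr => j _; rewrite lift0 exprSr mulrA.
Qed.

Lemma prod_subr_ffact (R : comPzRingType) (n a : nat) :
  \prod_(b < a) (b%:R - n%:R) = (-1) ^+ a * (n ^_ a)%:R :> R.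
Proof.
elim: a => [|a IHa]; first by rewrite big_ord0 ffactn0 mulr1.
rewrite big_ord_recr /= IHa ffactnSr natrM exprS mulN1r.
have [lean|ltna] := leqP a n; last by rewrite ffact_small // !(mul0r, mulr0).
by rewrite natrB //; ring.
Qed.

Lemma sumn_kfib_rev (k n : nat) :
  sumn (kfib_rev k n) = (\sum_(0 <= i < n.+1) kfib k i%:Z)%N.
Proof.
elim: n => [|n IHn]; first by rewrite big_nat1.
by rewrite big_nat_recr //= IHn addnC.
Qed.

Lemma drop_kfib_rev (k n d : nat) :
  drop d (kfib_rev k n) = if (d <= n)%N then kfib_rev k (n - d) else [::].
Proof.
by elim: d n => [|d IHd] [|n]; rewrite ?drop0 ?subn0 //=.
Qed.

(** With s_n the partial sum, this is s_(n+1) + s_(n-k) = 2 s_n, the recurrence encoded by 1 - 2x +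
    x^(k+1): the new term is s_n minus the dropped tail. *)
Lemma sumn_kfib_revS (k n : nat) :
  (sumn (kfib_rev k n.+1) + sumn (drop k (kfib_rev k n)) =
   2 * sumn (kfib_rev k n))%N.
Proof.
have := sumn_cat (take k (kfib_rev k n)) (drop k (kfib_rev k n)).
by rewrite cat_take_drop /= => E; lia.
Qed.

(* The truncated subtractions are harmless: where one truncates, a > 0 and the
   binomial vanishes. *)
Definition kfib_sum_term (k n a : nat) : rat :=
  (-1) ^+ a * 'C(n - a * k, a)%:R * 2 ^+ (n - a * k.+1).

Lemma kfib_sum_term0 (k n : nat) : kfib_sum_term k n 0 = 2 ^+ n.
Proof. by rewrite /kfib_sum_term !mul0n !subn0 bin0 !mul1r. Qed.

Lemma kfib_sum_term_small (k n a : nat) :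
  (n < k)%N -> kfib_sum_term k n a.+1 = 0.
Proof.
move=> ltnk; rewrite /kfib_sum_term (_ : n - _ = 0)%N ?bin0n ?mulr0 ?mul0r //.
by apply/eqP; rewrite subn_eq0 mulSn; lia.
Qed.

(** Pascal's rule for ['C(M.+1, a.+1)] with M = n - (a+1)k, matching the recurrence of the partial
    sums term by term. *)
Lemma kfib_sum_term_rec (k n a : nat) : (0 < k)%N -> (k <= n)%N ->
  kfib_sum_term k n.+1 a.+1 =
  2 * kfib_sum_term k n a.+1 - kfib_sum_term k (n - k) a.
Proof.
move=> k_gt0 lekn; rewrite /kfib_sum_term.
have -> : (n - k - a * k = n - a.+1 * k)%N by rewrite mulSn subnDA.
have [lean|ltna] := leqP (a.+1 * k)%N n; last first.
  have a_gt0 : (0 < a)%N by case: a ltna => //; lia.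
  have -> : (n - a.+1 * k = 0)%N by lia.
  have -> : (n.+1 - a.+1 * k = 0)%N by lia.
  by rewrite !bin0n; case: a a_gt0 {ltna} => // a _; rewrite !(mulr0, mul0r) subrr.
set M := (n - a.+1 * k)%N.
have -> : (n.+1 - a.+1 * k = M.+1)%N by rewrite subSn.
have -> : (n.+1 - a.+1 * k.+1 = M - a)%N by rewrite /M; lia.
have -> : (n - k - a * k.+1 = M - a)%N by rewrite /M; lia.
have -> : (n - a.+1 * k.+1 = M - a.+1)%N by rewrite /M; lia.
rewrite binS natrD exprS.
(* For M <= a the exponent [M - a.+1] truncates, but its coefficient ['C(M, a.+1)] is zero. *)
have [ltaM|leMa] := ltnP a M; last first.
  by rewrite (@bin_small M a.+1) //; ring.
by rewrite -(subnSK ltaM) exprS; ring.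
Qed.

(** Terms with ak > n vanish, so any such [B] serves; leaving it free lets the induction pass from
    (n, B) to (n - k, B - 1). *)
Lemma sumn_kfib_revE (k n B : nat) : (0 < k)%N -> (n < B * k)%N ->
  (sumn (kfib_rev k n))%:R = \sum_(a < B) kfib_sum_term k n a.
Proof.
move=> k_gt0; elim/ltn_ind: n B => -[|n] IHn [|B] // ltnB.
  rewrite big_ord_recl kfib_sum_term0 big1 ?addr0 // => a _.
  exact: kfib_sum_term_small.
have /(congr1 (fun x => x%:R : rat)) := sumn_kfib_revS k n.
rewrite natrD natrM (IHn n _ B.+1) ?(ltnW ltnB) // => /(canRL (addrK _)) ->.
rewrite !big_ord_recl !kfib_sum_term0 mulrDr -exprS -addrA; congr (_ + _).
rewrite drop_kfib_rev; case: leqP => [lekn|ltnk]; last first.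
  rewrite subr0 big1 ?mulr0 => [|a _]; last exact: kfib_sum_term_small.
  (* Here [n.+1] may equal [k], so [kfib_sum_term_small] does not apply; the binomial is still
     ['C(0, a.+1)]. *)
  rewrite big1 // => a _; rewrite lift0 /kfib_sum_term.
  rewrite (_ : n.+1 - _ = 0)%N ?bin0n ?mulr0 ?mul0r //.
  by apply/eqP; rewrite subn_eq0 mulSn; lia.
rewrite (IHn (n - k)%N _ B); [|lia|by move: ltnB; rewrite mulSn; lia].
rewrite mulr_sumr -sumrB; apply: eq_bigr => a _.
by rewrite lift0 kfib_sum_term_rec.
Qed.

(** Evaluate [sum_stirling1] at x = -t: the factors b + 1 - t equal b - (t - 1), giving a signed
    falling factorial of t - 1. *)
Lemma sum_stirling1_bin (t a : nat) : (0 < t)%N ->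
  \sum_(j < a.+1) (-1) ^+ j * (stirling1 a.+1 j.+1)%:R * t%:R ^+ j =
  (-1) ^+ a * 'C(t.-1, a)%:R * (a`!)%:R :> rat.
Proof.
case: t => // t _ /=.
transitivity (\sum_(j < a.+1) (stirling1 a.+1 j.+1)%:R * (- t.+1%:R : rat) ^+ j).
  by apply: eq_bigr => j _; rewrite [in RHS]exprNn mulrCA mulrA.
rewrite sum_stirling1 -mulrA -natrM bin_ffact -prod_subr_ffact.
by apply: eq_bigr => b _; rewrite -!natr1; ring.
Qed.

Theorem theorem1 (k m : nat) (hk : (1 <= k)%N) (hm : (1 <= m)%N) :
  \sum_(0 <= n < m * k) (kfib k n%:Z)%:R =
  \sum_(1 <= i < m.+1) \sum_(1 <= j < i.+1)
    (2 ^+ ((m - i + 1) * k) * (-1) ^+ (j - 1) * k%:R ^+ (j - 1)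
       * (stirling1 i j)%:R * (m - i + 1)%:R ^+ (j - 1))
    / (((i - 1)`!)%:R * 2 ^+ i) :> rat.
Proof.
have mk_gt0 : (0 < m * k)%N by rewrite muln_gt0 hm.
rewrite -natr_sum -{1}(prednK mk_gt0) -sumn_kfib_rev.
(* Taking B = m matches the outer sums termwise, with i = a + 1. *)
rewrite (@sumn_kfib_revE k _ m) ?prednK // big_add1 big_mkord.
apply: eq_bigr => a _; rewrite big_add1 big_mkord !subn1 /=.
have -> : (m - a.+1 + 1 = m - a)%N by rewrite addn1 subnSK.
set t := ((m - a) * k)%N.
have t_gt0 : (0 < t)%N by rewrite muln_gt0 subn_gt0 ltn_ord.
have a_fact : (a`!)%:R != 0 :> rat by rewrite pnatr_eq0 -lt0n fact_gt0.
have two_exp n : 2 ^+ n != 0 :> rat by rewrite expf_eq0 andbF.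
transitivity (2 ^+ t / ((a`!)%:R * 2 ^+ a.+1) *
  \sum_(j < a.+1) (-1) ^+ j * (stirling1 a.+1 j.+1)%:R * t%:R ^+ j : rat).
  rewrite sum_stirling1_bin // /kfib_sum_term.
  have -> : ((m * k).-1 - a * k = t.-1)%N by rewrite /t mulnBl; lia.
  have -> : ((m * k).-1 - a * k.+1 = t - a.+1)%N by rewrite /t mulnBl; lia.
  (* If t <= a, then ['C(t.-1, a)] is zero; otherwise 2^t / 2^(a+1) is a genuine power of 2. *)
  have [leat|ltta] := leqP a.+1 t; last first.
    by rewrite bin_small ?(mulr0, mul0r) //; lia.
  rewrite -[X in 2 ^+ X / _](subnK leat) exprD.
  by field; rewrite a_fact two_exp.
rewrite mulr_sumr; apply: eq_bigr => j _.
by rewrite subn1 /= /t natrM exprMn; field; rewrite a_fact two_exp.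
Qed.
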